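(* Suppose $q$ is a power of $2$. Let $U\le\mathbb{F}_q$ be an $\mathbb{F}_2$-linear subspace of dimension $d$, let $a\in\mathbb{F}_q$, and let $\mathcal{A}=a+U\subseteq\mathbb{F}_q$, $r=|\mathcal{A}|=2^d$. Let $s=2^u$ with $u\ge1$. Choose $\lambda\in\mathbb{F}_q^\ast$, and let $V=(v_{i,\alpha})\in(\mathbb{F}_q^\ast)^{s\times r}$ be a multiplier matrix, with columns indexed by the evaluation points $\alpha\in\mathcal{A}$, such that \[ v_{i,\alpha}v_{s-i+1,\alpha}=\lambda,\qquad 1\le i\le s,\quad\alpha\in\mathcal{A}. \] Then the HRS code $C=\operatorname{HRS}_{\frac{rs}{2}}(\mathcal{A},V,s,r)$ is reverse self-dual.
   Context: For an integer $h\ge 0$, $\mathcal{P}_{<h}=\{f\in\mathbb{F}_q[x]:\deg f<h\}$. Hasse derivative: for $f(x)=\sum_\ell f_\ell x^\ell\in\mathbb{F}_q[x]$ and $j\ge0$, $\partial^{(j)}f(x)=\sum_{\ell}\binom{\ell}{j}f_\ell x^{\ell-j}$ (with $\binom{\ell}{j}=0$ if $j>\ell$, binomials reduced modulo the characteristic). Hyperderivative Reed–Solomon (HRS) code: for a set $\mathcal{A}=\{\alpha_1,\ldots,\alpha_r\}$ of $r$ distinct elements of $\mathbb{F}_q$, $V=(v_{i,j})\in(\mathbb{F}_q^\ast)^{s\times r}$ (one may index columns by the points $\alpha\in\mathcal{A}$ themselves) and $0\le k\le rs$, \[ \operatorname{HRS}_k(\mathcal{A},V,s,r)=\left\{\bigl(v_{i,j}\,\partial^{(i-1)}f(\alpha_j)\bigr)_{1\le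 i\le s,\,1\le j\le r}: f\in\mathcal{P}_{<k}\right\}\subseteq\operatorname{Mat}_{s\times r}(\mathbb{F}_q). \] Reverse bilinear form on $\operatorname{Mat}_{s\times r}(\mathbb{F}_q)$: $[A,B]_{\rm rev}=\sum_{j=1}^r\sum_{i=1}^s a_{i,j}b_{s-i+1,j}$. The reverse dual of a linear code $C$ is $C^{\perp_{\rm rev}}=\{B:[A,B]_{\rm rev}=0\text{ for all }A\in C\}$, and $C$ is reverse self-dual if $C=C^{\perp_{\rm rev}}$. *)

(* Defs.v *)
From HB Require Import structures.
From mathcomp Require Export all_boot all_order all_algebra all_field.

Set Implicit Arguments.
Unset Strict Implicit.
Unset Printing Implicit Defensive.

Import GRing.Theory.
Local Open Scope ring_scope.

Section HRS.
Variables (F : finFieldType) (s r : nat).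

(* The evaluation set is given by an enumeration [alpha], so that column [j]
   of a matrix belongs to the point [alpha j].  Rows are numbered from [0]:
   row [i] carries the [i]-th Hasse derivative, which is [f^`N(i)].
   [{poly_k F}] is the space of polynomials of size at most [k], that is, of
   degree less than [k]. *)
Definition hrs_word (alpha : 'I_r -> F) (V : 'M[F]_(s, r)) (f : {poly F}) :
    'M[F]_(s, r) :=
  \matrix_(i < s, j < r) (V i j * (f^`N(i)).[alpha j]).

Definition HRS (k : nat) (alpha : 'I_r -> F) (V : 'M[F]_(s, r)) :
    {set 'M[F]_(s, r)} :=
  [set hrs_word alpha V f | f : {poly_k F}].

(* With rows numbered from [0], [rev_ord i] is [s - 1 - i]. *)
Definition rev_form (A B : 'M[F]_(s, r)) : F :=
  \sum_(j < r) \sum_(i < s) A i j * B (rev_ord i) j.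

Definition rev_dual (C : {set 'M[F]_(s, r)}) : {set 'M[F]_(s, r)} :=
  [set B | [forall A in C, rev_form A B == 0]].

Definition rev_self_dual (C : {set 'M[F]_(s, r)}) : Prop := C = rev_dual C.

End HRS.

(* Main.v *)
(** By the Leibniz rule for Hasse derivatives, the form evaluated at the words of
    [f] and [g] is [lam] times the sum over the evaluation set [A] of the
    [(s-1)]-st Hasse derivative of [h = f g].  As [s] is a power of the
    characteristic, only the monomials [x^(k s + s - 1)] of [h] contribute, each
    through the [s]-th power of the power sum [\sum_(x in A) x ^ k].  Since [A]
    is a coset of an additive group, these power sums vanish for [k < r - 1],
    and the one for [k = r - 1] is a nonzero [c].  So the form equals
    [lam c^s h_(rs-1)] whenever [deg h < rs], which gives self-orthogonality.
    Conversely, by Hermite interpolation each [B] is the word of some [g] of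
    degree less than [rs]; if [deg g >= rs/2], then [x^(rs-1-deg g)] is a
    codeword polynomial whose word is not orthogonal to [B]. *)

Require Import Defs.
From mathcomp Require Import zify ring.

Set Implicit Arguments.
Unset Strict Implicit.
Unset Printing Implicit Defensive.

Import GRing.Theory.
Local Open Scope ring_scope.

(** * Hasse derivatives and multiplicity of roots *)

(** Taylor expansion: moving the point to 0 turns Hasse derivatives into plain coefficients. *)
Lemma coef_comp_XaddC (R : comNzRingType) (p : {poly R}) (x : R) (i : nat) :
  (p \Po ('X + x%:P))`_i = (p^`N(i)).[x].
Proof.
(* The Taylor sum is taken long enough to contain the index [i] even beyond the degree of [p]. *)
rewrite /comp_poly addrC (nderiv_taylor_wide (n := size p + i.+1)); last first.
- by rewrite (leq_trans (size_poly _ _)) ?leq_addr.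
- exact: mulrC.
rewrite (eq_bigr (fun j : 'I__ => (p^`N(j)).[x] *: 'X^j)) => [|j _].
  have lt_i : (i < size p + i.+1)%N by lia.
  rewrite coef_sumMXn big_mkcond (bigD1 (Ordinal lt_i)) //= eqxx big1 ?addr0 //.
  by move=> j; rewrite -val_eqE /= => /negPf->.
by rewrite nderivn_map horner_map /= mul_polyC.
Qed.

Lemma horner_nderivnM (R : comNzRingType) (p q : {poly R}) (x : R) (n : nat) :
  ((p * q)^`N(n)).[x] = \sum_(i < n.+1) (p^`N(i)).[x] * (q^`N(n - i)).[x].
Proof.
rewrite -coef_comp_XaddC comp_polyM coefM.
by apply: eq_bigr => i _; rewrite !coef_comp_XaddC.
Qed.

(** After translating [x] to 0, the coefficients below degree [n] vanish, so ['X^n] divides; then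
    translate back. *)
Lemma dvdp_XsubC_exp (F : fieldType) (p : {poly F}) (x : F) (n : nat) :
  (forall i, (i < n)%N -> (p^`N(i)).[x] = 0) -> ('X - x%:P) ^+ n %| p.
Proof.
move=> p0; set q := p \Po ('X + x%:P).
have : 'X^n %| q.
  have <- : drop_poly n q * 'X^n = q.
    rewrite -[RHS](poly_take_drop n); suff -> : take_poly n q = 0 by rewrite add0r.
    apply/polyP => i; rewrite coef_take_poly coef0; case: ifP => // /p0.
    by rewrite coef_comp_XaddC.
  exact: dvdp_mulIr.
move/(dvdp_comp_poly ('X - x%:P)).
by rewrite comp_polyXaddC_K rmorphXn /= comp_polyX.
Qed.

(** Powers of linear factors at distinct points are coprime. *)
Lemma dvdp_prod_XsubC_exp (F : fieldType) (s : seq F) (p : {poly F}) (n : nat) :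
    uniq s -> {in s, forall x i, (i < n)%N -> (p^`N(i)).[x] = 0} ->
  (\prod_(x <- s) ('X - x%:P)) ^+ n %| p.
Proof.
elim: s => [|x s IHs] /=; first by rewrite big_nil expr1n dvd1p.
move=> /andP[xs us] p0; rewrite big_cons exprMn Gauss_dvdp.
  rewrite dvdp_XsubC_exp => [|i]; last by apply: p0; rewrite mem_head.
  by apply: IHs => // y ys; apply: p0; rewrite in_cons ys orbT.
apply/coprimep_expl/coprimep_expr.
by rewrite coprimep_sym coprimep_XsubC root_prod_XsubC.
Qed.

(** * Power sums over an affine set *)

(* By translation invariance, the derivative of [\prod_(x in A) ('X - x)] takes
   the same value [c] at all points of [A], so that this is the leading
   coefficient of the Lagrange interpolation formula for [p]. *)
Lemma sum_horner_affine (F : finFieldType) (A : {set F}) (x0 : F)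
    (p : {poly F}) :
    {in A & &, forall x y z, x - y + z \in A} -> x0 \in A ->
    (size p <= #|A|)%N ->
  \sum_(x in A) p.[x] = (\prod_(y in A :\ x0) (x0 - y)) * p`_#|A|.-1.
Proof.
move=> affA Ax0 szp; set c := \prod_(y in _) _.
have cE x : x \in A -> \prod_(y in A :\ x) (x - y) = c.
  (* Translation by [x - x0] carries [A :\ x0] onto [A :\ x] and preserves differences. *)
  move=> Ax; rewrite (reindex_inj (addrI (x - x0))) /=.
  apply: eq_big => y; last by move=> _; ring.
  rewrite !inE; congr (~~ _ && _).
    by rewrite -subr_eq0 -[RHS]subr_eq0; congr (_ == 0); ring.
  apply/idP/idP => Ay; last exact: affA.
  by have := affA _ _ _ Ax0 Ax Ay; congr (_ \in A); ring.
pose L x : {poly F} := \prod_(y in A :\ x) ('X - y%:P).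
have szL x : x \in A -> size (L x) = #|A|.
  by move=> Ax; rewrite /L -big_enum size_prod_XsubC -cardE (cardsD1 x A) Ax.
have LE x y : x \in A -> y \in A -> (L x).[y] = c *+ (x == y).
  move=> Ax Ay; rewrite /L horner_prod; case: eqVneq => [<-|neq_xy].
    by rewrite -(cE x Ax); apply: eq_bigr => z _; rewrite hornerXsubC.
  by rewrite (bigD1 y) ?inE 1?eq_sym ?neq_xy //= hornerXsubC subrr mul0r.
(* [P] has size at most [#|A|] and vanishes on all of [A]. *)
pose P := \sum_(x in A) p.[x] *: L x - c *: p.
have : P = 0.
  apply: (@roots_geq_poly_eq0 _ _ (enum A)); rewrite ?enum_uniq //.
    apply/allP => y; rewrite mem_enum => Ay; rewrite rootE /P !hornerE horner_sum.
    rewrite (bigD1 y) //= big1 ?addr0 => [|x /andP[Ax /negPf xy]].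
      by rewrite hornerZ LE // eqxx mulr1n mulrC subrr.
    by rewrite hornerZ LE // xy mulr0n mulr0.
  rewrite -cardE; apply: (leq_trans (size_polyD _ _)); rewrite geq_max.
  rewrite size_polyN (leq_trans (size_scale_leq _ _)) // andbT.
  apply: (leq_trans (size_sum _ _ _)); apply/bigmax_leqP => x Ax.
  by rewrite (leq_trans (size_scale_leq _ _)) ?szL.
move/(congr1 (fun q : {poly F} => q`_#|A|.-1)); rewrite coef0 coefB coefZ coef_sum.
move/eqP; rewrite subr_eq0 => /eqP <-; apply: eq_bigr => x Ax.
have : lead_coef (L x) = 1.
  by apply/eqP; rewrite -[_ == _]/(_ \is monic) /L -big_enum monic_prod_XsubC.
by rewrite coefZ lead_coefE szL // => ->; rewrite mulr1.
Qed.

(* The [s]-th power of ['X + x] being ['X^s + x ^+ s], the power of ['X] with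
   exponent [s - 1] only comes from the remainder of [l] modulo [s]. *)
Lemma horner_nderivn_Xn (R : comNzRingType) (p e l : nat) (x : R) :
    p \in [pchar R] ->
  (('X^l)^`N((p ^ e).-1)).[x] =
    x ^+ (p ^ e * (l %/ p ^ e)) *+ (l %% p ^ e == (p ^ e).-1)%N.
Proof.
move=> pR; set s := (p ^ e)%N.
have s_gt0 : (0 < s)%N by rewrite expn_gt0 prime_gt0 ?(pcharf_prime pR).
rewrite -coef_comp_XaddC rmorphXn /= comp_polyX {1}(divn_eq l s) mulnC exprD exprM.
have pP : p \in [pchar {poly R}].
  by rewrite (rmorph_pchar (polyC : {rmorphism _ -> _})).
rewrite exprDn_pchar ?pnatX ?(pnatE _ (pcharf_prime pR)) ?pP //.
have lt_ms := ltn_pmod l s_gt0; set t := (l %% s)%N in lt_ms *.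
(* All binomial terms but the first carry a factor ['X^s], hence miss the coefficient of index
   [s - 1]. *)
rewrite [_ + x%:P ^+ s]addrC exprDn big_ord_recl mulrDl coefD.
rewrite [X in _ + X](_ : _ = 0) ?addr0; last first.
  rewrite mulr_suml coef_sum big1 // => i _.
  by rewrite /= exprS mulrCA -mulrnAr -mulrA coefXnM prednK // leqnn.
rewrite subn0 expr0 mulr1 bin0 mulr1n -exprM -rmorphXn /= coefCM -mulr_natr.
have -> : 'X + x%:P = 'X - (- x)%:P by rewrite polyCN opprK.
(* [('X + x)^t] is monic of degree [t < s]: its coefficient of index [s - 1] is 1 or 0. *)
congr (_ * _); case: eqP => [<-|neq_t]; last first.
  by rewrite nth_default // size_exp_XsubC; lia.
have /monicP := monic_exp t (monicXsubC (- x)).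
by rewrite lead_coefE size_exp_XsubC.
Qed.

Lemma sum_horner_nderivn_affine (F : finFieldType) (A : {set F}) (x0 : F)
    (p e : nat) (h : {poly F}) :
    p \in [pchar F] -> {in A & &, forall x y z, x - y + z \in A} -> x0 \in A ->
    (size h <= #|A| * p ^ e)%N ->
  \sum_(x in A) (h^`N((p ^ e).-1)).[x] =
    (\prod_(y in A :\ x0) (x0 - y)) ^+ (p ^ e) * h`_(#|A| * p ^ e).-1.
Proof.
move=> pF affA Ax0; set s := (p ^ e)%N; set c := \prod_(y in _) _ => szh.
have s_gt0 : (0 < s)%N by rewrite expn_gt0 prime_gt0 ?(pcharf_prime pF).
have A_gt0 : (0 < #|A|)%N by apply/card_gt0P; exists x0.
have N_gt0 : (0 < #|A| * s)%N by rewrite muln_gt0 A_gt0.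
(* By Frobenius, this sum is the [s]-th power of the sum of the [x ^+ k]. *)
have sumX k : (k < #|A|)%N ->
    \sum_(x in A) x ^+ (s * k) = c ^+ s *+ (k == #|A|.-1).
  move=> ltkA; have -> : c ^+ s *+ (k == #|A|.-1) = (c *+ (k == #|A|.-1)) ^+ s.
    by case: eqP => // _; rewrite !mulr0n expr0n -[s == _]negbK -lt0n s_gt0.
  have -> : c *+ (k == #|A|.-1) = \sum_(x in A) x ^+ k.
    have := sum_horner_affine (p := 'X^k) affA Ax0; rewrite size_polyXn => /(_ ltkA).
    rewrite coefXn mulr_natr eq_sym => <-.
    by apply: eq_bigr => x _; rewrite hornerXn.
  have expD : {morph (fun y : F => y ^+ s) : y z / y + z}.
    by move=> y z; rewrite exprDn_pchar // pnatX (pnatE _ (pcharf_prime pF)) pF.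
  have exp0 : 0 ^+ s = 0 :> F by rewrite expr0n -[s == _]negbK -lt0n s_gt0.
  rewrite (big_morph _ expD exp0).
  by apply: eq_bigr => x _; rewrite mulnC exprM.
have -> : h = \sum_(l < #|A| * s) h`_l *: 'X^l.
  rewrite -poly_def; apply/polyP => i; rewrite coef_poly; case: ltnP => // leNi.
  by rewrite nth_default // (leq_trans szh).
rewrite -poly_def coef_poly prednK // leqnn poly_def linear_sum /=.
under eq_bigr do rewrite horner_sum.
rewrite exchange_big /=.
have ltN : ((#|A| * s).-1 < #|A| * s)%N by rewrite prednK.
have divN : (#|A| * s).-1 = (#|A|.-1 * s + s.-1)%N.
  by move: A_gt0 s_gt0; case: #|A| => // n _; case: (s) => // t _; lia.
rewrite (bigD1 (Ordinal ltN)) //= [X in _ + X]big1 ?addr0 => [|l /eqP neql].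
  under eq_bigr => x _ do rewrite linearZ /= hornerZ horner_nderivn_Xn // -/s.
  rewrite divN divnMDl // modnMDl modn_small ?divn_small ?prednK // addn0 eqxx.
  by rewrite -mulr_sumr sumX ?prednK // eqxx mulrC.
under eq_bigr => x _ do rewrite linearZ /= hornerZ horner_nderivn_Xn // -/s.
(* A lower index with remainder [s - 1] has quotient below [#|A| - 1], where the power sum
   vanishes. *)
rewrite -mulr_sumr; case: eqP => [lmod|_]; last by rewrite big1 ?mulr0.
rewrite sumX ?ltn_divLR //; case: eqP => [ldiv|]; last by rewrite mulr0.
by case: neql; apply: val_inj; rewrite /= divN -lmod -ldiv -divn_eq.
Qed.

(** * The reverse form on words and self-duality *)

(** Orders [i] and [s - 1 - i] are paired, so each column yields a Leibniz sum of order [s - 1]. *)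
Lemma rev_form_hrs_word (F : finFieldType) (s r : nat) (alpha : 'I_r -> F)
    (V : 'M[F]_(s, r)) (lam : F) (f g : {poly F}) :
    (0 < s)%N -> (forall i j, V i j * V (rev_ord i) j = lam) ->
  rev_form (hrs_word alpha V f) (hrs_word alpha V g) =
    lam * \sum_(j < r) ((f * g)^`N(s.-1)).[alpha j].
Proof.
case: s V => // s V _ hV; rewrite mulr_sumr; apply: eq_bigr => j _.
rewrite horner_nderivnM mulr_sumr; apply: eq_bigr => i _.
by rewrite !mxE /= subSS -(hV i j); ring.
Qed.

(** A nonzero polynomial of degree less than [r * s] cannot vanish to order [s] at [r] points. So
    the word map is injective there, and cardinalities agree. *)
Lemma hrs_word_surj (F : finFieldType) (s r : nat) (alpha : 'I_r -> F)
    (V B : 'M[F]_(s, r)) :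
    injective alpha -> (forall i j, V i j != 0) ->
  exists2 f : {poly F}, (size f <= r * s)%N & hrs_word alpha V f = B.
Proof.
move=> alpha_inj V_neq0.
have hrs_inj : injective (fun f : {poly_(r * s) F} => hrs_word alpha V f).
  move=> f g /matrixP eq_fg; apply/val_inj/eqP; rewrite -subr_eq0 /=.
  set h := _ - _; apply: contraTT isT => h_neq0.
  have szh : (size h <= r * s)%N.
    by rewrite (leq_trans (size_polyD _ _)) // geq_max size_polyN !size_npoly.
  have /(dvdp_leq h_neq0) :
      (\prod_(x <- map alpha (enum 'I_r)) ('X - x%:P)) ^+ s %| h.
    apply: dvdp_prod_XsubC_exp; first by rewrite map_inj_uniq ?enum_uniq.
    move=> _ /mapP[j _ ->] i ltis; have := eq_fg (Ordinal ltis) j.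
    rewrite !mxE => /(mulfI (V_neq0 _ _)) /= eq_ij.
    by rewrite linearB /= !hornerE eq_ij subrr.
  have monP : \prod_(x <- map alpha (enum 'I_r)) ('X - x%:P) \is monic.
    exact: monic_prod_XsubC.
  have := size_prod_XsubC (map alpha (enum 'I_r)) id.
  rewrite size_map size_enum_ord => szP.
  have expP := size_exp (\prod_(x <- map alpha (enum 'I_r)) ('X - x%:P)) s.
  have neq0 := monic_neq0 (monic_exp s monP); rewrite -size_poly_gt0 in neq0.
  by rewrite -(prednK neq0) expP szP /= => /leq_trans/(_ szh); rewrite ltnn.
have /inj_card_bij/(_ _)[] := hrs_inj.
  by rewrite card_npoly card_mx mulnC.
by move=> g _ gK; exists (g B); [exact: size_npoly | exact: gK].
Qed.

Lemma HRS_affine_rev_self_dual (F : finFieldType) (p e n s r : nat)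
    (alpha : 'I_r -> F) (V : 'M[F]_(s, r)) (lam : F) :
    p \in [pchar F] -> s = (p ^ e)%N -> (r * s = n.*2)%N -> (0 < r)%N ->
    injective alpha ->
    {in codom alpha & &, forall x y z, x - y + z \in codom alpha} ->
    lam != 0 -> (forall i j, V i j != 0) ->
    (forall i j, V i j * V (rev_ord i) j = lam) ->
  rev_self_dual (HRS n alpha V).
Proof.
move=> pF hs rsE r_gt0 alpha_inj aff lam_neq0 V_neq0 hV.
have s_gt0 : (0 < s)%N by rewrite hs expn_gt0 prime_gt0 ?(pcharf_prime pF).
have rs_gt0 : (0 < r * s)%N by rewrite muln_gt0 r_gt0.
pose A := [set x in codom alpha].
have cardA : #|A| = r by rewrite cardsE card_codom // card_ord.
pose x0 := alpha (Ordinal r_gt0).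
have Ax0 : x0 \in A by rewrite inE codom_f.
have affA : {in A & &, forall x y z, x - y + z \in A}.
  by move=> x y z; rewrite !inE; exact: aff.
have [c c_neq0 formE] : exists2 c : F, c != 0 & forall f g : {poly F},
    (size (f * g)%R <= r * s)%N ->
  rev_form (hrs_word alpha V f) (hrs_word alpha V g) = c * (f * g)`_(r * s).-1.
  exists (lam * (\prod_(y in A :\ x0) (x0 - y)) ^+ s).
    rewrite mulf_neq0 ?expf_neq0 //; apply/prodf_neq0 => y.
    by rewrite !inE subr_eq0 eq_sym => /andP[].
  move=> f g szfg; rewrite (rev_form_hrs_word _ _ _ s_gt0 hV) -mulrA; congr (_ * _).
  have := sum_horner_nderivn_affine (e := e) (h := f * g) pF affA Ax0.
  rewrite cardA -hs => /(_ szfg) <-.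
  rewrite -(big_imset (h := alpha) (fun x => ((f * g)^`N(s.-1)).[x])) /=.
    apply: eq_bigl => x; rewrite inE.
    by apply/imsetP/codomP => [[j _ ->]|[j ->]]; exists j.
  by move=> i j _ _; exact: alpha_inj.
apply/setP => B; rewrite inE.
apply/imsetP/forall_inP => [[g _ ->] _ /imsetP[f _ ->]|dualB].
  (* Both degrees are below [n], so the product has degree at most [r * s - 2]. *)
  have szfg : (size (val f * val g)%R <= (r * s).-1)%N.
    rewrite (leq_trans (size_polyMleq _ _)) //.
    have := size_npoly f; have := size_npoly g; rewrite /=; lia.
  by rewrite formE ?nth_default ?mulr0 // (leq_trans szfg) ?leq_pred.
have [g szg defB] := hrs_word_surj B alpha_inj V_neq0.
have [szgn|ltng] := leqP (size g) n.
  by exists (NPoly szgn).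
have [k sz_gk] : exists k, size g = k by exists (size g).
rewrite sz_gk in szg ltng.
(* Since [k > n] and [r * s = n.*2], the exponent is below [n]; the shift moves the leading
   coefficient of [g] to index [r * s - 1]. *)
have szX : (size ('X^(r * s - k) : {poly F}) <= n)%N by rewrite size_polyXn; lia.
have g_neq0 : g != 0 by rewrite -size_poly_gt0 sz_gk; lia.
have /dualB : hrs_word alpha V 'X^(r * s - k) \in HRS n alpha V.
  by apply/imsetP; exists (NPoly szX).
rewrite -defB formE; last first.
  by rewrite (leq_trans (size_polyMleq _ _)) // size_polyXn sz_gk; lia.
rewrite coefXnM ifN; last by rewrite -leqNgt; lia.
have -> : ((r * s).-1 - (r * s - k) = k.-1)%N by lia.
rewrite mulf_eq0 (negPf c_neq0) /= -sz_gk -lead_coefE lead_coef_eq0.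
by rewrite (negPf g_neq0).
Qed.

Theorem theorem17 (F : finFieldType) (m : nat) (hq : #|F| = (2 ^ m)%N)
    (U : {vspace pPrimeCharType (card_finPcharP hq isT)})
    (d : nat) (hd : \dim U = d)
    (a : F) (A : {set F}) (hA : A = [set a + (u : F) | u in U])
    (r : nat) (alpha : 'I_r -> F) (alpha_inj : injective alpha)
    (alphaA : [set alpha j | j : 'I_r] = A)
    (u s : nat) (hu : (1 <= u)%N) (hs : s = (2 ^ u)%N)
    (lam : F) (hlam : lam != 0)
    (V : 'M[F]_(s, r)) (V_neq0 : forall i j, V i j != 0)
    (hV : forall i j, V i j * V (rev_ord i) j = lam) :
  r = (2 ^ d)%N /\ rev_self_dual (HRS ((r * s) %/ 2) alpha V).
Proof.
have rE : r = (2 ^ d)%N.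
  have <- : #|A| = r by rewrite -alphaA card_imset // card_ord.
  rewrite hA card_imset; last exact: addrI.
  by have := card_vspace U; rewrite hd card_Fp.
split=> //.
have codomE x : (x \in codom alpha) = (x \in A).
  by rewrite -alphaA; apply/codomP/imsetP => [[j ->]|[j _ ->]]; exists j.
apply: (HRS_affine_rev_self_dual (card_finPcharP hq isT) hs _ _ alpha_inj _ hlam) => //.
(* As [u >= 1], [s] is even and the halving is exact. *)
- by rewrite -muln2 divnK // hs -(prednK hu) expnS mulnCA dvdn_mulr.
- by rewrite rE expn_gt0.
move=> x y z; rewrite !codomE hA => /imsetP[v Uv ->] /imsetP[w Uw ->].
move=> /imsetP[t Ut ->]; apply/imsetP; exists (v - w + t).
  exact: (memvD (memvB Uv Uw) Ut).
(* The vector space structure over the prime field has the addition of [F]. *)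
by change (a + v - (a + w) + (a + t) = a + (v - w + t) :> F); ring.
Qed.
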